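(* The following two representations hold: $$\mathrm{elh}(\mathbb{C})=W_R\cup\bigcup_{p\in\mathcal{M}}R_p(\mathrm{elh}(\mathbb{C}))\qquad\text{and}\qquad \mathrm{elh}(\mathbb{C})=W_L\cup\bigcup_{p\in\mathcal{M}}L_p(\mathrm{elh}(\mathbb{C})).$$ (That is, every $f\in\mathrm{elh}(\mathbb{C})$ lies in $W_R$ or is of the form $g\circ p$ with $p\in\mathcal{M}$, $g\in\mathrm{elh}(\mathbb{C})$; and every $f\in\mathrm{elh}(\mathbb{C})$ lies in $W_L$ or is of the form $p\circ g$ with $p\in\mathcal{M}$, $g\in\mathrm{elh}(\mathbb{C})$.)
   Context: $\mathrm{elh}(\mathbb{C})$ is the set of all entire functions $f:\mathbb{C}\to\mathbb{C}$ with $f'(z)\neq 0$ for all $z\in\mathbb{C}$ and $f'(0)=1$. $\mathrm{Aut}(\mathbb{C})=\{z+a : a\in\mathbb{C}\}\subseteq\mathrm{elh}(\mathbb{C})$. For $f\in\mathrm{elh}(\mathbb{C})$ the right and left shifts are $R_f(g)=g\circ f$ and $L_f(g)=f\circ g$ for $g\in\mathrm{elh}(\mathbb{C})$; compositions are understood in $\mathrm{elh}(\mathbb{C})$, i.e. $R_p(\mathrm{elh}(\mathbb{C}))$ and $L_p(\mathrm{elh}(\mathbb{C}))$ are regarded as sets of those compositions satisfying the normalization $f'(0)=1$. A function $c\in\mathrm{elh}(\mathbb{C})$ is composite if there are entire functions $f,g$, neither of which is an affine map $z\mapsto \alpha z+\beta$ ($\alpha\in\mathbb{C}^\times$, $\beta\in\mathbb{C}$),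 such that $c=f\circ g$ (the factors need not lie in $\mathrm{elh}(\mathbb{C})$). A function $p\in\mathrm{elh}(\mathbb{C})\setminus\mathrm{Aut}(\mathbb{C})$ is prime if it is not composite. $\mathcal{M}$ is the set of all primes in $\mathrm{elh}(\mathbb{C})$. Finally, $W_R$ is the set of $f\in\mathrm{elh}(\mathbb{C})$ such that whenever $f=p\circ q$ with $p,q$ entire and not affine, then $q\notin\mathcal{M}$; and $W_L$ is the set of $f\in\mathrm{elh}(\mathbb{C})$ such that whenever $f=p\circ q$ with $p,q$ entire and not affine, then $p\notin\mathcal{M}$. *)

(* Defs.v *)
(* Stdlib / Coquelicot: C is Coquelicot's field of complex numbers. *)
From Stdlib Require Import Reals.
From Stdlib Require Import Basics.
From Coquelicot Require Import Coquelicot.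

Open Scope C_scope.

(* ex_derive over the scalar field C is complex differentiability.  C_derive is
   a total operator, and it equals the complex derivative (is_C_derive_unique)
   only at points where ex_derive holds. *)
Definition entire (f : C -> C) : Prop :=
  forall z : C, ex_derive (K := C_AbsRing) (V := C_NormedModule) f z.

Definition affine (f : C -> C) : Prop :=
  exists alpha beta : C, alpha <> 0 /\ f = (fun z => alpha * z + beta).

Definition elh (f : C -> C) : Prop :=
  entire f /\ (forall z : C, C_derive f z <> 0) /\ C_derive f 0 = 1.

Definition Aut (f : C -> C) : Prop :=
  exists a : C, f = (fun z => z + a).

Definition R_shift (f g : C -> C) : C -> C := compose g f.
Definition L_shift (f g : C -> C) : C -> C := compose f g.

(* For g and p in elh the composition need not have derivative 1 at 0; the
   images keep only the compositions which do. *)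
Definition R_image (p f : C -> C) : Prop :=
  exists g : C -> C, elh g /\ f = R_shift p g /\ C_derive f 0 = 1.

Definition L_image (p f : C -> C) : Prop :=
  exists g : C -> C, elh g /\ f = L_shift p g /\ C_derive f 0 = 1.

(* Constants are not affine in the above sense, but they never occur as factors
   of an element of elh. *)
Definition composite (c : C -> C) : Prop :=
  elh c /\
  exists f g : C -> C,
    entire f /\ entire g /\ ~ affine f /\ ~ affine g /\ c = compose f g.

Definition prime (p : C -> C) : Prop :=
  elh p /\ ~ Aut p /\ ~ composite p.

Definition W_R (f : C -> C) : Prop :=
  elh f /\
  forall p q : C -> C,
    entire p -> entire q -> ~ affine p -> ~ affine q ->
    f = compose p q -> ~ prime q.

Definition W_L (f : C -> C) : Prop :=
  elh f /\
  forall p q : C -> C,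
    entire p -> entire q -> ~ affine p -> ~ affine q ->
    f = compose p q -> ~ prime p.

(* Main.v *)
Require Import Defs.
From Stdlib Require Import Reals Basics Lra Lia Classical ClassicalEpsilon.
From Stdlib Require Import FunctionalExtensionality Ranalysis5.
From Coquelicot Require Import Coquelicot.

(* If f = p o q with one factor prime, an affine map is moved across the
   composition so that both factors become normalized at 0.  The chain rule
   then gives nonvanishing derivatives, except that in the right decomposition
   p' is controlled only on the image of q.  A prime q is surjective: if q omits
   a, then q - a has an entire square root, so that q = (a + c w^2) o r is
   composite.  The square root needs no Cauchy theory: a continuous root on a
   disc is a telescoping product of principal roots of
   h((k+1)z/N) / h(kz/N), roots on different discs agree along rays, and a
   continuous root of a nonvanishing entire function is differentiable. *)

Local Open Scope C_scope.

(** * Continuity and complex differentiability *)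

(** Coquelicot gives [C] a product and an absolute-value uniform structure. Stating continuity
    through [Cmod] fixes the latter, the one on the domain of [is_derive] over [C_AbsRing]. *)
Definition ccont (f : C -> C) (z : C) : Prop :=
  forall eps : R, (0 < eps)%R -> exists delta : R, (0 < delta)%R /\
    forall w : C, (Cmod (w - z) < delta)%R -> (Cmod (f w - f z) < eps)%R.

Notation C_deriv_at := (is_derive (K := C_AbsRing) (V := C_NormedModule)).

Lemma ccont_continuous (f : C -> C) (z : C) :
  ccont f z <->
  continuous (T := AbsRing_UniformSpace C_AbsRing)
    (U := AbsRing_UniformSpace C_AbsRing) f z.
Proof.
split.
- intros H P [eps HP].
  destruct (H eps (cond_pos eps)) as [d [Hd H']].
  exists (mkposreal d Hd). intros w Hw. apply HP, H', Hw.
- intros H eps Heps.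
  destruct (H (fun y => Cmod (y - f z) < eps)%R) as [d Hd].
  + exists (mkposreal eps Heps). intros y Hy. exact Hy.
  + exists d; split; [apply cond_pos | exact Hd].
Qed.

Lemma ccont_const (c z : C) : ccont (fun _ => c) z.
Proof. rewrite ccont_continuous.
exact (continuous_const (U := AbsRing_UniformSpace C_AbsRing)
         (V := AbsRing_UniformSpace C_AbsRing) c z). Qed.

Lemma ccont_id (z : C) : ccont (fun w => w) z.
Proof. rewrite ccont_continuous.
exact (continuous_id (U := AbsRing_UniformSpace C_AbsRing) z). Qed.

Lemma ccont_plus (f g : C -> C) (z : C) :
  ccont f z -> ccont g z -> ccont (fun w => f w + g w) z.
Proof.
rewrite !ccont_continuous.
exact (continuous_plus (U := AbsRing_UniformSpace C_AbsRing)
         (V := AbsRing_NormedModule C_AbsRing) f g z).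
Qed.

Lemma ccont_mult (f g : C -> C) (z : C) :
  ccont f z -> ccont g z -> ccont (fun w => f w * g w) z.
Proof.
rewrite !ccont_continuous.
exact (continuous_mult (U := AbsRing_UniformSpace C_AbsRing)
         (K := C_AbsRing) f g z).
Qed.

Lemma ccont_comp (f g : C -> C) (z : C) :
  ccont g z -> ccont f (g z) -> ccont (fun w => f (g w)) z.
Proof.
rewrite !ccont_continuous.
exact (continuous_comp (U := AbsRing_UniformSpace C_AbsRing)
         (V := AbsRing_UniformSpace C_AbsRing)
         (W := AbsRing_UniformSpace C_AbsRing) g f z).
Qed.

Lemma ccont_ext_loc (f g : C -> C) (z : C) (d : R) : (0 < d)%R ->
  (forall w, Cmod (w - z) < d -> f w = g w)%R -> ccont f z -> ccont g z.
Proof.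
intros Hd Hfg Hf eps Heps.
destruct (Hf eps Heps) as [d' [Hd' H]].
exists (Rmin d d'); split; [now apply Rmin_glb_lt|].
intros w Hw.
rewrite <- !Hfg.
- apply H. eapply Rlt_le_trans; [exact Hw | apply Rmin_r].
- replace (z - z) with (RtoC 0) by ring. now rewrite Cmod_0.
- eapply Rlt_le_trans; [exact Hw | apply Rmin_l].
Qed.

Lemma Cmod_triangle_inv (a b : C) : (Cmod a - Cmod b <= Cmod (a - b))%R.
Proof.
pose proof (Cmod_triangle (a - b) b) as H.
replace (a - b + b) with a in H by ring. lra.
Qed.

Lemma ccont_inv (z : C) : z <> 0 -> ccont Cinv z.
Proof.
intros Hz eps Heps.
assert (Hm : (0 < Cmod z)%R) by now apply Cmod_gt_0.
(* The first bound keeps [Cmod w] above [Cmod z / 2]; the second then controls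
   [(w - z) / (w * z)]. *)
exists (Rmin (Cmod z / 2) (eps * (Cmod z * Cmod z / 2))); split.
{ apply Rmin_glb_lt; [lra|]. apply Rmult_lt_0_compat; [lra|]. nra. }
intros w Hw.
pose proof (Rmin_l (Cmod z / 2) (eps * (Cmod z * Cmod z / 2))) as H1.
pose proof (Rmin_r (Cmod z / 2) (eps * (Cmod z * Cmod z / 2))) as H2.
assert (H3 : (Cmod z / 2 < Cmod w)%R).
{ pose proof (Cmod_triangle_inv z w) as H.
  replace (z - w) with (- (w - z)) in H by ring. rewrite Cmod_opp in H. lra. }
assert (Hw0 : w <> 0) by (apply Cmod_gt_0; lra).
replace (/ w - / z) with (- ((w - z) / (w * z))) by (field; now split).
rewrite Cmod_opp, Cmod_div, Cmod_mult by now apply Cmult_neq_0.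
assert (H4 : (0 < eps * Cmod z * (Cmod w - Cmod z / 2))%R).
{ apply Rmult_lt_0_compat; [now apply Rmult_lt_0_compat | lra]. }
apply Rlt_div_l; [apply Rmult_lt_0_compat |]; lra.
Qed.

(* Caratheodory's form of differentiability. *)
Lemma C_deriv_at_iff (f : C -> C) (z l : C) :
  C_deriv_at f z l <->
  exists phi : C -> C, ccont phi z /\ phi z = l /\
    forall w, f w = f z + phi w * (w - z).
Proof.
split.
- intros [_ H].
  specialize (H z (fun P HP => HP)).
  exists (fun w => if excluded_middle_informative (w = z) then l
                   else (f w - f z) / (w - z)).
  split; [|split].
  + intros eps Heps.
    (* The little-o condition has a non-strict bound; halving [eps] makes it strict. *)
    assert (He2 : (0 < eps / 2)%R) by lra.
    destruct (H (mkposreal _ He2)) as [d Hd].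
    exists d; split; [apply cond_pos|].
    intros w Hw.
    destruct (excluded_middle_informative (z = z)) as [_|n]; [|now elim n].
    destruct (excluded_middle_informative (w = z)) as [_|n].
    { replace (l - l) with (RtoC 0) by ring. now rewrite Cmod_0. }
    assert (Hn : w - z <> 0) by (intros E; apply n; replace w with (w - z + z) by ring; rewrite E; ring).
    specialize (Hd w Hw).
    change (Cmod ((f w - f z) - (w - z) * l) <= eps / 2 * Cmod (w - z))%R in Hd.
    replace ((f w - f z) / (w - z) - l)
      with (((f w - f z) - (w - z) * l) / (w - z)) by now field.
    rewrite Cmod_div by exact Hn.
    assert (Hm : (0 < Cmod (w - z))%R) by now apply Cmod_gt_0.
    apply Rlt_div_l; nra.
  + now destruct (excluded_middle_informative (z = z)) as [_|n]; [|elim n].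
  + intros w. destruct (excluded_middle_informative (w = z)) as [->|n]; [ring|].
    field. intros E; apply n; replace w with (w - z + z) by ring; rewrite E; ring.
- intros [phi [Hc [<- Hf]]].
  split; [apply is_linear_scal_l|].
  intros x Hx.
  (* [is_derive] quantifies over every limit [x] of the neighbourhood filter of [z]; uniqueness of
     limits leaves only [z]. *)
  replace x with z in *; cycle 1.
  { apply (is_filter_lim_unique (K := C_AbsRing) (V := AbsRing_NormedModule C_AbsRing) (F := locally (T := AbsRing_UniformSpace C_AbsRing) z)).
    - intros P HP; exact HP.
    - exact Hx. }
  intros eps.
  destruct (Hc eps (cond_pos eps)) as [d [Hd H]].
  exists (mkposreal d Hd). intros w Hw.
  specialize (H w Hw).
  change (Cmod ((f w - f z) - (w - z) * phi z) <= eps * Cmod (w - z))%R.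
  rewrite (Hf w).
  replace (f z + phi w * (w - z) - f z - (w - z) * phi z)
    with ((phi w - phi z) * (w - z)) by ring.
  rewrite Cmod_mult. apply Rmult_le_compat_r; [apply Cmod_ge_0 | lra].
Qed.

Lemma C_deriv_at_cont (f : C -> C) (z l : C) : C_deriv_at f z l -> ccont f z.
Proof.
rewrite C_deriv_at_iff. intros [phi [Hc [_ Hf]]].
apply (ccont_ext_loc (fun w => f z + phi w * (w + - z)) f z 1); [lra| |].
- intros w _. now rewrite (Hf w).
- apply ccont_plus; [apply ccont_const|].
  apply ccont_mult; [exact Hc|].
  apply ccont_plus; [apply ccont_id | apply ccont_const].
Qed.

(** In Caratheodory's form the slopes multiply, with no case distinction where [g w = g z]. *)
Lemma C_deriv_at_comp (f g : C -> C) (z lf lg : C) :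
  C_deriv_at f (g z) lf -> C_deriv_at g z lg ->
  C_deriv_at (fun w => f (g w)) z (lf * lg).
Proof.
intros Hf Hg. pose proof (C_deriv_at_cont _ _ _ Hg) as Hgc.
apply C_deriv_at_iff in Hf as [phi [Hc [<- Hf]]].
apply C_deriv_at_iff in Hg as [psi [Hc' [<- Hg]]].
apply C_deriv_at_iff.
exists (fun w => phi (g w) * psi w); split; [|split; [reflexivity|]].
- apply ccont_mult; [now apply ccont_comp | exact Hc'].
- intros w. rewrite (Hf (g w)).
  replace (g w - g z) with (psi w * (w - z)) by (rewrite (Hg w); ring).
  ring.
Qed.

Lemma C_deriv_at_quadratic (a b c z : C) :
  C_deriv_at (fun w => a + b * w + c * (w * w)) z (b + c * (z + z)).
Proof.
apply C_deriv_at_iff. exists (fun w => b + c * (w + z)); split; [|split; [reflexivity|]].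
- apply ccont_plus; [apply ccont_const|].
  apply ccont_mult; [apply ccont_const|].
  apply ccont_plus; [apply ccont_id | apply ccont_const].
- intros w. ring.
Qed.

Lemma C_deriv_at_affine (a b z : C) : C_deriv_at (fun w => a * w + b) z a.
Proof.
apply C_deriv_at_iff. exists (fun w => a); split; [|split; [reflexivity|]].
- apply ccont_const.
- intros w. ring.
Qed.

Lemma entire_deriv (f : C -> C) (z : C) : entire f -> C_deriv_at f z (C_derive f z).
Proof. intros Hf. apply C_derive_correct; [exact z | apply Hf]. Qed.

Lemma entire_cont (f : C -> C) (z : C) : entire f -> ccont f z.
Proof. intros Hf. eapply C_deriv_at_cont, entire_deriv, Hf. Qed.

Lemma entire_comp (f g : C -> C) : entire f -> entire g -> entire (compose f g).
Proof.
intros Hf Hg z. eexists.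
apply (C_deriv_at_comp f g); apply entire_deriv; assumption.
Qed.

Lemma C_derive_comp (f g : C -> C) (z : C) : entire f -> entire g ->
  C_derive (compose f g) z = C_derive f (g z) * C_derive g z.
Proof.
intros Hf Hg. apply is_C_derive_unique.
apply (C_deriv_at_comp f g); apply entire_deriv; assumption.
Qed.

Lemma entire_affine (a b : C) : entire (fun w => a * w + b).
Proof. intros z. eexists. apply C_deriv_at_affine. Qed.

Lemma C_derive_affine (a b z : C) : C_derive (fun w => a * w + b) z = a.
Proof. apply is_C_derive_unique, C_deriv_at_affine. Qed.

(** * The principal square root on the right half-plane *)

(** The principal root: [w + Cmod w] bisects the angle between [w] and the positive axis, and its
    squared modulus is [2 * Cmod w * (Re w + Cmod w)]. *)
Definition csqrt (w : C) : C := (w + Cmod w) / sqrt (2 * (Re w + Cmod w)).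

Lemma csqrt_spec (w : C) : (0 < Re w)%R ->
  csqrt w * csqrt w = w /\ (0 < Re (csqrt w))%R.
Proof.
intros Hw.
pose proof (Cmod_ge_0 w) as Hm.
assert (Hp : (0 < sqrt (2 * (Re w + Cmod w)))%R) by (apply sqrt_lt_R0; lra).
pose proof (sqrt_sqrt (2 * (Re w + Cmod w)) ltac:(lra)) as Hs.
assert (Hm2 : (Cmod w * Cmod w = Re w * Re w + Im w * Im w)%R).
{ pose proof (Cmod2_alt w). lra. }
set (s := sqrt (2 * (Re w + Cmod w))) in *.
assert (E : csqrt w = ((Re w + Cmod w) / s, Im w / s)%R).
{ unfold csqrt. fold s.
  assert (Hs0 : RtoC s <> 0) by (intros E; apply RtoC_inj in E; lra).
  replace (((Re w + Cmod w) / s, Im w / s)%R : C) with (((Re w + Cmod w)%R, Im w) * / RtoC s).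
  - unfold Cdiv. f_equal. destruct w as [x y]; unfold Cplus, RtoC; simpl; f_equal; ring.
  - rewrite <- RtoC_inv by lra. unfold Cmult, RtoC; simpl. f_equal; field; lra. }
rewrite E. split.
- destruct w as [x y]; unfold Re, Im in *; cbn [fst snd] in *.
  unfold Cmult; cbn [fst snd].
  set (m := Cmod (x, y)) in *.
  f_equal.
  (* Since [m * m = x * x + y * y], the new numerator equals [2 * x * (x + m)]. *)
  + replace ((x + m) / s * ((x + m) / s) - y / s * (y / s))%R
      with (((x + m) * (x + m) - y * y) / (s * s))%R by (field; lra).
    rewrite Hs. apply Rmult_eq_reg_r with (2 * (x + m))%R; [|lra].
    field_simplify; [|lra]. nra.
  + replace ((x + m) / s * (y / s) + y / s * ((x + m) / s))%R
      with (2 * (x + m) * y / (s * s))%R by (field; lra).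
    rewrite Hs. field. lra.
- unfold Re at 1; simpl. apply Rdiv_lt_0_compat; lra.
Qed.

(** The difference of two roots is [w' - w] divided by their sum, and the real part of that sum
    exceeds [Re (csqrt w)]. *)
Lemma csqrt_cont (w : C) : (0 < Re w)%R -> ccont csqrt w.
Proof.
intros Hw eps Heps.
destruct (csqrt_spec w Hw) as [Hs Hp].
exists (Rmin (Re w) (eps * Re (csqrt w))); split.
{ apply Rmin_glb_lt; [exact Hw | now apply Rmult_lt_0_compat]. }
intros w' Hw'.
pose proof (Rmin_l (Re w) (eps * Re (csqrt w))) as H1.
pose proof (Rmin_r (Re w) (eps * Re (csqrt w))) as H2.
assert (Hw0 : (0 < Re w')%R).
{ pose proof (re_le_Cmod (w' - w)) as H.
  change (Re (w' - w)) with (Re w' - Re w)%R in H. apply Rabs_le_between in H. lra. }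
destruct (csqrt_spec w' Hw0) as [Hs' Hp'].
pose proof (re_le_Cmod (csqrt w' + csqrt w)) as H.
rewrite re_plus in H. apply Rabs_le_between in H.
assert (E : w' - w = (csqrt w' - csqrt w) * (csqrt w' + csqrt w)).
{ rewrite <- Hs, <- Hs' at 1. ring. }
rewrite E, Cmod_mult in Hw'.
pose proof (Cmod_ge_0 (csqrt w' - csqrt w)) as H0.
apply Rmult_lt_reg_r with (Re (csqrt w)); [exact Hp|].
eapply Rle_lt_trans; [|eapply Rlt_le_trans; [exact Hw' | exact H2]].
apply Rmult_le_compat_l; lra.
Qed.

Lemma csqrt_1 : csqrt 1 = 1.
Proof.
unfold csqrt. rewrite Cmod_1.
replace (2 * (Re 1 + 1))%R with (2 * 2)%R by (simpl; ring).
rewrite sqrt_square by lra.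
rewrite <- RtoC_plus, <- RtoC_div by lra. f_equal. field.
Qed.

(** * Quotients of nearby values of a nonvanishing function *)

(** The sign is that of [a1 * b1 + a2 * b2], where real parts exceed 3/4 and imaginary parts are
    below 1/4 in absolute value. *)
Lemma Re_div_pos_near_1 (a b : C) :
  (Cmod (a - 1) < 1 / 4)%R -> (Cmod (b - 1) < 1 / 4)%R -> (0 < Re (a / b))%R.
Proof.
intros Ha Hb.
pose proof (Rmax_Cmod (a - 1)) as Ha'. pose proof (Rmax_Cmod (b - 1)) as Hb'.
destruct a as [a1 a2], b as [b1 b2]; cbn [fst snd Cminus Cplus Copp RtoC] in *.
pose proof (Rle_trans _ _ _ (Rmax_l _ _) Ha') as A1.
pose proof (Rle_trans _ _ _ (Rmax_r _ _) Ha') as A2.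
pose proof (Rle_trans _ _ _ (Rmax_l _ _) Hb') as B1.
pose proof (Rle_trans _ _ _ (Rmax_r _ _) Hb') as B2.
apply Rabs_le_between in A1, A2, B1, B2.
unfold Cdiv, Cmult, Cinv, Re; cbn [fst snd].
replace (a1 * (b1 / (b1 ^ 2 + b2 ^ 2)) - a2 * (- b2 / (b1 ^ 2 + b2 ^ 2)))%R
  with ((a1 * b1 + a2 * b2) / (b1 ^ 2 + b2 ^ 2))%R by (field; nra).
apply Rdiv_lt_0_compat; nra.
Qed.

(** Both [h w / h c] and [h w' / h c] are close to 1, and their quotient is [h w / h w']. *)
Lemma Re_div_pos_locally (h : C -> C) (c : C) : ccont h c -> h c <> 0 ->
  exists delta : R, (0 < delta)%R /\ forall w w' : C,
    (Cmod (w - c) < delta)%R -> (Cmod (w' - c) < delta)%R ->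
    (0 < Re (h w / h w'))%R.
Proof.
intros Hh Hc.
assert (Hm : (0 < Cmod (h c))%R) by now apply Cmod_gt_0.
destruct (Hh (Cmod (h c) / 4)%R) as [d [Hd H]]; [lra|].
exists d; split; [exact Hd|]. intros w w' Hw Hw'.
assert (K : forall u, (Cmod (u - c) < d)%R -> (Cmod (h u / h c - 1) < 1 / 4)%R).
{ intros u Hu. replace (h u / h c - 1) with ((h u - h c) / h c) by now field.
  rewrite Cmod_div by exact Hc. specialize (H u Hu). apply Rlt_div_l; lra. }
pose proof (Re_div_pos_near_1 _ _ (K w Hw) (K w' Hw')) as P.
assert (Hw0 : h w' <> 0).
{ intros E. specialize (H w' Hw'). rewrite E in H.
  replace (0 - h c) with (- h c) in H by ring. rewrite Cmod_opp in H. lra. }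
now replace (h w / h c / (h w' / h c)) with (h w / h w') in P by (field; now split).
Qed.

Lemma Cmod_le_Rabs (z : C) : (Cmod z <= Rabs (Re z) + Rabs (Im z))%R.
Proof.
replace z with (RtoC (Re z) + RtoC (Im z) * Ci) at 1.
- eapply Rle_trans; [apply Cmod_triangle|].
  rewrite Cmod_mult, !Cmod_R, Cmod_Ci. lra.
- destruct z as [x y]; unfold Ci, Cplus, Cmult, RtoC; simpl. f_equal; ring.
Qed.

(** A Lebesgue number argument on the square of half-side [rad], which contains the disc. *)
Lemma Re_div_pos_disc (h : C -> C) (rad : R) :
  (forall z, ccont h z) -> (forall z, h z <> 0) ->
  exists delta : R, (0 < delta)%R /\ forall w w' : C,
    (Cmod w <= rad)%R -> (Cmod w' < rad)%R -> (Cmod (w - w') < delta)%R ->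
    (0 < Re (h w / h w'))%R.
Proof.
intros Hh Hn.
(* The factor 3: [w'] lies within [d] of [(u, v)] in each coordinate, hence within [2 * d] in
   modulus, and [w] is less than a further [d] away. *)
assert (Hex : forall u v : R, { d : posreal | forall w w' : C,
    (Cmod (w - (u, v)) < 3 * d)%R -> (Cmod (w' - (u, v)) < 3 * d)%R ->
    (0 < Re (h w / h w'))%R }).
{ intros u v. apply constructive_indefinite_description.
  destruct (Re_div_pos_locally h (u, v) (Hh _) (Hn _)) as [d [Hd H]].
  assert (Hd3 : (0 < d / 3)%R) by lra.
  exists (mkposreal _ Hd3). intros w w' Hw Hw'. simpl in *. apply H; lra. }
destruct (compactness_value_2d (- rad) rad (- rad) rad
            (fun u v => proj1_sig (Hex u v))) as [d Hd].
exists d; split; [apply cond_pos|]. intros w w' Hw Hw' Hww.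
pose proof (re_le_Cmod w') as Hr.
assert (Hi : (Rabs (Im w') <= Cmod w')%R)
  by (eapply Rle_trans; [apply Rmax_r | apply Rmax_Cmod]).
apply Rabs_le_between in Hr, Hi.
(* [compactness_value_2d] provides its covering point only under a double negation. *)
apply NNPP. intros Hneg.
apply (Hd (Re w') (Im w')); [lra | lra |].
intros [u [v [_ [_ [Hu [Hv Hduv]]]]]]. apply Hneg.
destruct (Hex u v) as [e He]; cbn [proj1_sig] in *.
assert (Hw'c : (Cmod (w' - (u, v)) < 2 * e)%R).
{ eapply Rle_lt_trans; [apply Cmod_le_Rabs|].
  change (Re (w' - (u, v))) with (Re w' - u)%R.
  change (Im (w' - (u, v))) with (Im w' - v)%R. lra. }
apply He.
- replace (w - (u, v)) with ((w - w') + (w' - (u, v))) by ring.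
  eapply Rle_lt_trans; [apply Cmod_triangle | lra].
- pose proof (cond_pos e). lra.
Qed.

(** * Square roots on discs and on the whole plane *)

Lemma Csqr_eq_1 (u : C) : u * u = 1 -> u = 1 \/ u = - (1).
Proof.
intros H.
destruct (classic (u - 1 = 0)) as [E|E].
- left. replace u with (u - 1 + 1) by ring. rewrite E. ring.
- right. replace u with ((u * u - 1) / (u - 1) - 1) by now field.
  rewrite H. field. exact E.
Qed.

Lemma continuity_pt_ray (f : C -> C) (z : C) (t : R) :
  ccont f (t * z) -> continuity_pt (fun s : R => Re (f (s * z))) t.
Proof.
intros H. apply continuity_pt_locally. intros eps.
destruct (H eps (cond_pos eps)) as [d [Hd H']].
pose proof (Cmod_ge_0 z) as Hz.
(* Adding 1 keeps the denominator positive when [z = 0]. *)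
assert (Hd' : (0 < d / (Cmod z + 1))%R) by (apply Rdiv_lt_0_compat; lra).
exists (mkposreal _ Hd'). intros s Hs.
change (Rabs (s - t) < d / (Cmod z + 1))%R in Hs.
apply Rlt_div_r in Hs; [|lra].
eapply Rle_lt_trans; [apply (re_le_Cmod (f (s * z) - f (t * z)))|].
apply H'. replace (s * z - t * z) with (RtoC (s - t) * z) by (rewrite RtoC_minus; ring).
rewrite Cmod_mult, Cmod_R. pose proof (Rabs_pos (s - t)). nra.
Qed.

(** The value at [0] selects one of the two branches, so that roots on different discs can be
    glued. *)
Definition disc_sqrt (h : C -> C) (rad : R) (r : C -> C) : Prop :=
  r 0 = 1 /\ forall z, (Cmod z < rad)%R -> ccont r z /\ r z * r z = h z.

Lemma ccont_dilate (h : C -> C) (t z : C) :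
  ccont h (t * z) -> ccont (fun w => h (t * w)) z.
Proof.
intros H. apply (ccont_comp h (fun w => t * w)); [|exact H].
apply ccont_mult; [apply ccont_const | apply ccont_id].
Qed.

Lemma disc_sqrt_exists (h : C -> C) (rad : R) :
  (forall z, ccont h z) -> (forall z, h z <> 0) -> h 0 = 1 -> (0 < rad)%R ->
  exists r, disc_sqrt h rad r.
Proof.
intros Hh Hn H1 Hrad.
destruct (Re_div_pos_disc h rad Hh Hn) as [d [Hd Hpos]].
(* With [m] the integer part of [rad / d], taking [N = S m] makes [rad / N] smaller than [d]. *)
destruct (nfloor_ex (rad / d)) as [m [_ Hm]].
{ apply Rlt_le, Rdiv_lt_0_compat; assumption. }
set (N := S m).
assert (HN : (0 < INR N)%R) by (apply lt_0_INR; unfold N; lia).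
assert (HNd : (rad / INR N < d)%R).
{ unfold N in *. rewrite S_INR in *. apply Rlt_div_l in Hm; [|exact Hd].
  apply Rlt_div_l; lra. }
clearbody N.
(* At [k = 0] the dilated function is the constant [h 0 = 1]; at [k = N] it is [h]. *)
assert (K : forall k, (k <= N)%nat ->
          exists r, disc_sqrt (fun z => h (RtoC (INR k / INR N) * z)) rad r).
{ induction k as [|k IH]; intros Hk.
  - exists (fun _ => 1). split; [reflexivity|]. intros z _.
    split; [apply ccont_const|].
    replace (INR 0 / INR N)%R with 0%R by (change (INR 0) with 0%R; field; lra).
    rewrite Cmult_0_l, H1. ring.
  - destruct IH as [r [Hr0 Hr]]; [lia|].
    set (t := RtoC (INR k / INR N)) in *.
    set (t' := RtoC (INR (S k) / INR N)).
    (* The points [t' * z] and [t * z] stay in the disc and are [Cmod z / N < d] apart, so the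
       quotient has a principal root. *)
    assert (Hp : forall z, (Cmod z < rad)%R -> (0 < Re (h (t' * z)%C / h (t * z)%C))%R).
    { intros z Hz. pose proof (Cmod_ge_0 z) as Hz0.
      assert (Hk1 : (0 <= INR k)%R) by apply pos_INR.
      assert (Hk2 : (INR k + 1 <= INR N)%R) by (rewrite <- S_INR; now apply le_INR).
      assert (T : (0 <= INR k / INR N)%R) by (apply Rdiv_le_0_compat; lra).
      assert (T1 : (INR k / INR N <= 1)%R) by (apply Rle_div_l; lra).
      assert (T' : (0 <= INR (S k) / INR N <= 1)%R).
      { rewrite S_INR. split; [apply Rdiv_le_0_compat | apply Rle_div_l]; lra. }
      apply Hpos; unfold t, t'.
      - rewrite Cmod_mult, Cmod_R, Rabs_pos_eq by apply T'. nra.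
      - rewrite Cmod_mult, Cmod_R, Rabs_pos_eq by exact T. nra.
      - replace (RtoC (INR (S k) / INR N) * z - RtoC (INR k / INR N) * z)
          with (RtoC (/ INR N) * z).
        + rewrite Cmod_mult, Cmod_R, Rabs_pos_eq by (apply Rlt_le, Rinv_0_lt_compat, HN).
          eapply Rlt_trans; [|exact HNd]. unfold Rdiv. rewrite Rmult_comm.
          apply Rmult_lt_compat_r; [apply Rinv_0_lt_compat, HN | exact Hz].
        + replace (/ INR N)%R with (INR (S k) / INR N - INR k / INR N)%R
            by (rewrite S_INR; field; lra).
          rewrite RtoC_minus. ring. }
    exists (fun z => r z * csqrt (h (t' * z) * / h (t * z))). split.
    + rewrite !Cmult_0_r, H1, Hr0. replace (1 * / 1) with (RtoC 1) by (field; apply C1_nz).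
      rewrite csqrt_1. ring.
    + intros z Hz. destruct (Hr z Hz) as [Hc E]. specialize (Hp z Hz). split.
      * apply ccont_mult; [exact Hc|].
        apply (ccont_comp csqrt (fun w => h (t' * w) * / h (t * w))); [|now apply csqrt_cont].
        apply ccont_mult; [now apply ccont_dilate|].
        apply (ccont_comp Cinv (fun w => h (t * w))); [now apply ccont_dilate | now apply ccont_inv].
      * destruct (csqrt_spec _ Hp) as [Hs _]. unfold Cdiv in Hs.
        set (s := csqrt _) in *.
        replace (r z * s * (r z * s)) with ((r z * r z) * (s * s)) by ring.
        rewrite Hs, E. field. apply Hn. }
destruct (K N (Nat.le_refl N)) as [r [Hr0 Hr]].
exists r. split; [exact Hr0|]. intros z Hz. destruct (Hr z Hz) as [Hc E].
split; [exact Hc|]. rewrite E. f_equal.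
replace (INR N / INR N)%R with 1%R by (field; lra). ring.
Qed.

(** The quotient of the roots takes only the values 1 and -1 and is 1 at [0]. If it were -1 at [z],
    its real part would vanish somewhere on the segment from [0] to [z]. *)
Lemma disc_sqrt_unique (h : C -> C) (rad1 rad2 : R) (r1 r2 : C -> C) (z : C) :
  (forall z, h z <> 0) -> disc_sqrt h rad1 r1 -> disc_sqrt h rad2 r2 ->
  (Cmod z < rad1)%R -> (Cmod z < rad2)%R -> r1 z = r2 z.
Proof.
intros Hn [H10 H1] [H20 H2] Hz1 Hz2.
assert (Hr2 : forall w, (Cmod w < rad2)%R -> r2 w <> 0).
{ intros w Hw E. destruct (H2 w Hw) as [_ H]. apply (Hn w). rewrite <- H, E. ring. }
set (phi := fun w => r1 w * / r2 w).
assert (Hray : forall t, (0 <= t <= 1)%R -> (Cmod (t * z) < rad1 /\ Cmod (t * z) < rad2)%R).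
{ intros t Ht. rewrite Cmod_mult, Cmod_R, Rabs_pos_eq by lra.
  pose proof (Cmod_ge_0 z). split; nra. }
assert (Hphi : forall t, (0 <= t <= 1)%R -> phi (t * z) = 1 \/ phi (t * z) = - (1)).
{ intros t Ht. destruct (Hray t Ht) as [A B].
  destruct (H1 _ A) as [_ E1]. destruct (H2 _ B) as [_ E2].
  apply Csqr_eq_1. unfold phi.
  replace (r1 (t * z) * / r2 (t * z) * (r1 (t * z) * / r2 (t * z)))
    with ((r1 (t * z) * r1 (t * z)) / (r2 (t * z) * r2 (t * z)))
    by (field; now apply Hr2).
  rewrite E1, E2. field. apply Hn. }
destruct (Hphi 1%R) as [E|E]; [lra | |]; rewrite Cmult_1_l in E.
- unfold phi in E. replace (r1 z) with (r1 z * / r2 z * r2 z) by (field; now apply Hr2).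
  rewrite E. ring.
- exfalso.
  (* The sign is reversed because [IVT_interv] expects a passage from negative to positive. *)
  destruct (IVT_interv (fun t : R => Ropp (Re (phi (t * z)))) 0 1) as [t [Ht E0]].
  + intros t Ht. destruct (Hray t Ht) as [A B].
    apply continuity_pt_opp, continuity_pt_ray.
    apply ccont_mult; [now apply H1|].
    apply (ccont_comp Cinv r2); [now apply H2 | now apply ccont_inv, Hr2].
  + lra.
  + rewrite Cmult_0_l. unfold phi. rewrite H10, H20.
    replace (1 * / 1) with (RtoC 1) by (field; apply C1_nz). simpl. lra.
  + rewrite Cmult_1_l, E. simpl. lra.
  + destruct (Hphi t Ht) as [E1|E1]; rewrite E1 in E0; simpl in E0; lra.
Qed.

(** The value at [z] is read off a root on some disc containing [z]; by [disc_sqrt_unique] the disc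
    does not matter, so near [z] the result agrees with a single disc root. *)
Lemma continuous_sqrt_exists (h : C -> C) :
  (forall z, ccont h z) -> (forall z, h z <> 0) -> h 0 = 1 ->
  exists r : C -> C, forall z, ccont r z /\ r z * r z = h z.
Proof.
intros Hh Hn H1.
assert (Hroot : forall z, { v : C | exists rad r,
          disc_sqrt h rad r /\ (Cmod z < rad)%R /\ v = r z }).
{ intros z. apply constructive_indefinite_description.
  destruct (disc_sqrt_exists h (Cmod z + 1)) as [r Hr]; try assumption.
  { pose proof (Cmod_ge_0 z); lra. }
  exists (r z), (Cmod z + 1)%R, r. split; [exact Hr|]. split; [lra | reflexivity]. }
exists (fun z => proj1_sig (Hroot z)). intros z.
destruct (disc_sqrt_exists h (Cmod z + 1)) as [r Hr]; try assumption.
{ pose proof (Cmod_ge_0 z); lra. }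
assert (E : forall w, (Cmod w < Cmod z + 1)%R -> r w = proj1_sig (Hroot w)).
{ intros w Hw. destruct (Hroot w) as [v [rad [r' [Hr' [Hw' ->]]]]]; simpl.
  now apply (disc_sqrt_unique h (Cmod z + 1) rad). }
assert (Hz : (Cmod z < Cmod z + 1)%R) by lra.
rewrite <- (E z Hz). split.
- apply (ccont_ext_loc r _ z 1); [lra | | now apply Hr].
  intros w Hw. apply E. pose proof (Cmod_triangle_inv w z). lra.
- now apply Hr.
Qed.

(** As [h w - h z] is [(r w - r z) * (r w + r z)], a slope function of [h] divided by [r w + r z] is
    one for [r]; at [z] the divisor is nonzero. *)
Lemma entire_sqrt_exists (h : C -> C) :
  entire h -> (forall z, h z <> 0) -> h 0 = 1 ->
  exists r : C -> C, entire r /\ forall z, r z * r z = h z.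
Proof.
intros Hh Hn H1.
destruct (continuous_sqrt_exists h) as [r Hr]; try assumption.
{ intros z. now apply entire_cont. }
assert (Hr0 : forall z, r z <> 0).
{ intros z E. apply (Hn z). destruct (Hr z) as [_ <-]. rewrite E. ring. }
exists r. split; [|intros z; apply Hr]. intros z.
pose proof (entire_deriv h z Hh) as D.
apply C_deriv_at_iff in D as [phi [Hc [_ Hphi]]].
assert (Hrz : r z + r z <> 0).
{ replace (r z + r z) with (RtoC 2 * r z) by ring. apply Cmult_neq_0; [|apply Hr0].
  intros E; apply RtoC_inj in E; lra. }
eexists. apply C_deriv_at_iff.
(* Where [r w + r z] vanishes the first formula is junk, so the difference
   quotient of [r] is used there; this does not happen near [z]. *)
set (psi := fun w => if excluded_middle_informative (r w + r z = 0)
                     then (r w - r z) / (w - z) else phi w * / (r w + r z)).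
exists psi. split; [|split; [reflexivity|]].
- destruct (Hr z) as [Hrc _].
  assert (Hs : ccont (fun w => r w + r z) z)
    by (apply ccont_plus; [exact Hrc | apply ccont_const]).
  destruct (Hs (Cmod (r z + r z))) as [d [Hd H]]; [now apply Cmod_gt_0|].
  apply (ccont_ext_loc (fun w => phi w * / (r w + r z)) psi z d Hd).
  + intros w Hw. unfold psi. destruct (excluded_middle_informative _) as [E|_]; [|reflexivity].
    specialize (H w Hw). rewrite E in H.
    replace (0 - (r z + r z)) with (- (r z + r z)) in H by ring.
    rewrite Cmod_opp in H. lra.
  + apply ccont_mult; [exact Hc|].
    apply (ccont_comp Cinv (fun w => r w + r z)); [exact Hs | now apply ccont_inv].
- intros w. unfold psi. destruct (excluded_middle_informative _) as [E|n].
  + field. intros E'. apply Hrz. replace z with w in * by (replace w with (w - z + z) by ring; rewrite E'; ring).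
    exact E.
  + destruct (Hr w) as [_ Ew]. destruct (Hr z) as [_ Ez].
    replace (phi w * / (r w + r z) * (w - z)) with ((phi w * (w - z)) / (r w + r z)) by now field.
    replace (phi w * (w - z)) with (r w * r w - r z * r z).
    * now field.
    * rewrite Ew, Ez, (Hphi w). ring.
Qed.

(** * Affine maps and primes *)

Lemma affine_intro (a b : C) : a <> 0 -> affine (fun z => a * z + b).
Proof. intros H. now exists a, b. Qed.

Lemma affine_id : affine (fun z => z).
Proof.
exists 1, 0. split; [apply C1_nz|].
apply functional_extensionality. intros z. ring.
Qed.

Lemma affine_entire (f : C -> C) : affine f -> entire f.
Proof. intros [a [b [_ ->]]]. apply entire_affine. Qed.

Lemma affine_comp (f g : C -> C) : affine f -> affine g -> affine (compose f g).
Proof.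
intros [a [b [Ha ->]]] [c [d [Hc ->]]].
exists (a * c), (a * d + b). split; [now apply Cmult_neq_0|].
apply functional_extensionality. intros z. unfold compose. ring.
Qed.

Lemma affine_inverse (f : C -> C) : affine f ->
  exists g, affine g /\ (forall z, f (g z) = z) /\ (forall z, g (f z) = z).
Proof.
intros [a [b [Ha ->]]]. exists (fun z => / a * z + (- (b / a))). split; [|split].
- apply affine_intro. intros E. apply Ha.
  replace a with (a * a * / a) by now field. rewrite E. ring.
- intros z. now field.
- intros z. now field.
Qed.

Lemma affine_cancel_l (f g : C -> C) : affine f -> affine (compose f g) -> affine g.
Proof.
intros Hf Hfg. destruct (affine_inverse f Hf) as [k [Hk [_ Hkf]]].
replace g with (compose k (compose f g)); [now apply affine_comp|].
apply functional_extensionality. intros z. apply Hkf.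
Qed.

Lemma affine_cancel_r (f g : C -> C) : affine g -> affine (compose f g) -> affine f.
Proof.
intros Hg Hfg. destruct (affine_inverse g Hg) as [k [Hk [Hgk _]]].
replace f with (compose (compose f g) k); [now apply affine_comp|].
apply functional_extensionality. intros z. unfold compose. now rewrite Hgk.
Qed.

(** Derivative 1 at [0] forces slope 1, so an affine element of [elh] is a translation. *)
Lemma prime_not_affine (p : C -> C) : prime p -> ~ affine p.
Proof.
intros [[_ [_ H0]] [HA _]] [a [b [_ E]]]. apply HA. exists b.
rewrite E, C_derive_affine in H0. rewrite E, H0.
apply functional_extensionality. intros z. ring.
Qed.

Lemma prime_factor_affine (p f g : C -> C) : prime p -> entire f -> entire g ->
  p = compose f g -> affine f \/ affine g.
Proof.
intros [Hp [_ Hc]] Hf Hg E. apply NNPP. intros Hn. apply Hc.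
split; [exact Hp|]. exists f, g. tauto.
Qed.

(** Undoing [s] on the left and [t] on the right turns a factorization of the new map into one of
    [p]. *)
Lemma prime_affine_change (p s t : C -> C) : prime p -> affine s -> affine t ->
  elh (compose s (compose p t)) -> prime (compose s (compose p t)).
Proof.
intros Hp Hs Ht He.
pose proof (prime_not_affine p Hp) as Hna.
split; [exact He|]. split.
- intros [a Ha]. apply Hna.
  apply (affine_cancel_r p t Ht), (affine_cancel_l s _ Hs).
  rewrite Ha. replace (fun z => z + a) with (fun z => 1 * z + a).
  + apply affine_intro, C1_nz.
  + apply functional_extensionality. intros z. ring.
- intros [_ [f [g [Hf [Hg [Hfa [Hga E]]]]]]].
  destruct (affine_inverse s Hs) as [s' [Hs' [Hss' Hs's]]].
  destruct (affine_inverse t Ht) as [t' [Ht' [Htt' Ht't]]].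
  destruct (prime_factor_affine p (compose s' f) (compose g t') Hp) as [H|H].
  + now apply entire_comp; [apply affine_entire|].
  + now apply entire_comp; [|apply affine_entire].
  + apply functional_extensionality. intros z.
    pose proof (f_equal (fun k => s' (k (t' z))) E) as Ez.
    unfold compose in *. now rewrite Hs's, Htt' in Ez.
  + apply Hfa, (affine_cancel_l s' f Hs' H).
  + apply Hga, (affine_cancel_r g t' Ht' H).
Qed.

(* If [p] omits [a] then [p - a] has an entire square root [r], and [p] factors
   as [a + c w^2] after [r]. *)
Lemma prime_surjective (p : C -> C) (a : C) : prime p -> exists z, p z = a.
Proof.
intros Hp. apply NNPP. intros Hom.
assert (Hn : forall z, p z - a <> 0).
{ intros z E. apply Hom. exists z. replace (p z) with (p z - a + a) by ring.
  rewrite E. ring. }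
pose proof (Hn 0) as Hc. set (c := p 0 - a) in *.
assert (Hci : / c <> 0).
{ intros E. apply C1_nz. replace (RtoC 1) with (c * / c) by now field. rewrite E. ring. }
(* The function is [(p - a) / c], scaled to take the value 1 at [0]. *)
destruct (entire_sqrt_exists (compose (fun w => / c * w + (- (a / c))) p)) as [r [Hr Hrr]].
- apply entire_comp; [apply entire_affine | apply Hp].
- intros z. unfold compose.
  replace (/ c * p z + - (a / c)) with (/ c * (p z - a)) by now field.
  now apply Cmult_neq_0.
- unfold compose. replace (/ c * p 0 + - (a / c)) with (/ c * (p 0 - a)) by now field.
  fold c. now field.
- unfold compose in Hrr.
  destruct (prime_factor_affine p (fun w => a + 0 * w + c * (w * w)) r Hp) as [H|H].
  + intros z. eexists. apply C_deriv_at_quadratic.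
  + exact Hr.
  + apply functional_extensionality. intros z. unfold compose. rewrite Hrr. now field.
  (* The quadratic takes equal values at 1 and -1, so an affine expression for it would have slope
     zero. *)
  + destruct H as [al [be [Hal E]]].
    pose proof (f_equal (fun k : C -> C => k 1) E) as E1.
    pose proof (f_equal (fun k : C -> C => k (- (1))) E) as E2. cbv beta in E1, E2.
    apply Hal.
    assert (E3 : al * 2 = 0).
    { replace (al * 2) with ((al * 1 + be) - (al * - (1) + be)) by ring.
      rewrite <- E1, <- E2. ring. }
    replace al with (al * 2 * / 2). { rewrite E3. ring. }
    field.
  (* An affine [r] vanishes at [k 0], where [p] would then take the omitted value. *)
  + destruct (affine_inverse r H) as [k [_ [Hk _]]].
    apply (Hn (k 0)).
    replace (p (k 0) - a) with (c * (/ c * p (k 0) + - (a / c))) by now field.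
    rewrite <- Hrr, Hk. ring.
Qed.

(** * Normalizing the factors, and the two representations *)

Lemma elh_comp (f g : C -> C) : elh f -> elh g -> C_derive (compose f g) 0 = 1 ->
  elh (compose f g).
Proof.
intros [Hf [Hf' _]] [Hg [Hg' _]] H0.
split; [now apply entire_comp|]. split; [|exact H0].
intros z. rewrite C_derive_comp by assumption. now apply Cmult_neq_0.
Qed.

Lemma elh_right_factor (p q : C -> C) (z : C) : entire p -> entire q ->
  elh (compose p q) -> C_derive p (q z) <> 0 /\ C_derive q z <> 0.
Proof.
intros Hp Hq [_ [H _]]. specialize (H z). rewrite C_derive_comp in H by assumption.
split; intros E; apply H; rewrite E; ring.
Qed.

Lemma R_decomposition (p q : C -> C) : entire p -> prime q -> elh (compose p q) ->
  exists q', prime q' /\ R_image q' (compose p q).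
Proof.
intros Hp Hq Hpq.
pose proof Hq as [[Hqe [Hq' Hq0]] _]. pose proof Hpq as [_ [_ H0]].
(* Translating by [q 0] makes the derivative of the left factor at [0] equal to that of [p] at
   [q 0], which is 1 because [q] has derivative 1 at [0]. *)
set (t := fun z : C => 1 * z + - q 0). set (t' := fun z : C => 1 * z + q 0).
assert (Ht : affine t) by apply affine_intro, C1_nz.
assert (Ht' : affine t') by apply affine_intro, C1_nz.
exists (compose t q). split; [|exists (compose p t'); split; [|split]].
- apply (prime_affine_change q t (fun z => z) Hq Ht affine_id).
  change (elh (compose t q)).
  assert (D : forall z, C_derive (compose t q) z = C_derive q z).
  { intros z. rewrite C_derive_comp by (trivial; now apply affine_entire).
    unfold t. rewrite C_derive_affine. ring. }
  split; [now apply entire_comp; [apply affine_entire|]|].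
  split; [intros z|]; rewrite D; trivial.
- assert (D : forall z, C_derive (compose p t') z = C_derive p (z + q 0)).
  { intros z. rewrite C_derive_comp by (trivial; now apply affine_entire).
    unfold t'. rewrite C_derive_affine, Cmult_1_l. ring. }
  split; [now apply entire_comp; [|apply affine_entire]|]. split.
  (* Surjectivity of [q] puts every point in its image, where the chain rule controls the derivative
     of [p]. *)
  + intros z. rewrite D. destruct (prime_surjective q (z + q 0) Hq) as [w <-].
    now apply elh_right_factor.
  + rewrite D, Cplus_0_l. rewrite C_derive_comp, Hq0, Cmult_1_r in H0 by assumption.
    exact H0.
- apply functional_extensionality. intros z. unfold R_shift, compose, t, t'.
  f_equal. ring.
- exact H0.
Qed.

Lemma L_decomposition (p q : C -> C) : prime p -> entire q -> elh (compose p q) ->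
  exists p', prime p' /\ L_image p' (compose p q).
Proof.
intros Hp Hq Hpq.
pose proof Hp as [[Hpe [Hp' Hp0]] _]. pose proof Hpq as [_ [_ H0]].
set (b := C_derive q 0).
assert (Hb : b <> 0) by now apply (elh_right_factor p q 0).
(* [t] is the first-order Taylor polynomial of [q] at [0]: removing it from [q] leaves derivative 1
   there, and [p] after [t] gets derivative [C_derive p (q 0) * b = 1] at [0]. *)
set (t := fun z : C => b * z + q 0).
assert (Ht : affine t) by now apply affine_intro.
destruct (affine_inverse t Ht) as [t' [Ht' [Htt' _]]].
exists (compose p t). split; [|exists (compose t' q); split; [|split]].
- apply (prime_affine_change p (fun z => z) t Hp affine_id Ht).
  change (elh (compose p t)).
  assert (D : forall z, C_derive (compose p t) z = C_derive p (t z) * b).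
  { intros z. rewrite C_derive_comp by (trivial; now apply affine_entire).
    unfold t at 2. now rewrite C_derive_affine. }
  split; [now apply entire_comp; [|apply affine_entire]|]. split.
  + intros z. rewrite D. now apply Cmult_neq_0.
  + rewrite D. unfold t. rewrite C_derive_comp in H0 by assumption.
    rewrite Cmult_0_r, Cplus_0_l. exact H0.
- assert (E : q = compose t (compose t' q)).
  { apply functional_extensionality. intros z. unfold compose. now rewrite Htt'. }
  assert (He : entire (compose t' q)) by now apply entire_comp; [apply affine_entire|].
  assert (D : forall z, C_derive q z = b * C_derive (compose t' q) z).
  { intros z. rewrite E at 1.
    rewrite C_derive_comp by (trivial; now apply affine_entire).
    unfold t at 1. now rewrite C_derive_affine. }
  split; [exact He|]. split.
  + intros z Ez. destruct (elh_right_factor p q z) as [_ Hz]; trivial.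
    apply Hz. rewrite D, Ez. ring.
  + replace (C_derive (compose t' q) 0) with (/ b * (b * C_derive (compose t' q) 0))
      by now field.
    rewrite <- D. fold b. now field.
- apply functional_extensionality. intros z. unfold L_shift, compose.
  now rewrite Htt'.
- exact H0.
Qed.

Theorem theorem3p8 :
  (forall f : C -> C,
     elh f <-> (W_R f \/ exists p : C -> C, prime p /\ R_image p f)) /\
  (forall f : C -> C,
     elh f <-> (W_L f \/ exists p : C -> C, prime p /\ L_image p f)).
Proof.
split; intros f; split.
- intros Hf. destruct (classic (W_R f)) as [HW|HW]; [now left | right].
  (* If no prime right shift reached [f], [R_decomposition] would exclude every factorization with
     prime inner factor, which puts [f] in [W_R]. *)
  apply NNPP. intros Hn. apply HW. split; [exact Hf|].
  intros p q Hp Hq _ _ -> Hpr. apply Hn. now apply R_decomposition.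
- intros [[Hf _] | [p [[Hp _] [g [Hg [-> H0]]]]]]; [exact Hf|].
  now apply elh_comp.
- intros Hf. destruct (classic (W_L f)) as [HW|HW]; [now left | right].
  apply NNPP. intros Hn. apply HW. split; [exact Hf|].
  intros p q Hp Hq _ _ -> Hpr. apply Hn. now apply L_decomposition.
- intros [[Hf _] | [p [[Hp _] [g [Hg [-> H0]]]]]]; [exact Hf|].
  now apply elh_comp.
Qed.
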